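(* The rational function $\mathbf{\Gamma}_T^{(1)}$ determines all double-degree numbers of $T$: if $T,T'$ are trees with $\mathbf{\Gamma}_T^{(1)}=\mathbf{\Gamma}_{T'}^{(1)}$, then $N_{a,b}(T)=N_{a,b}(T')$ for all positive integers $a,b$.
   Context: All graphs are finite and simple. For a tree $T$ and $S\subseteq E(T)$, let $\overline{S}$ be the set of vertices incident to some edge of $S$; define $\mathbf{\Gamma}_T^{(1)}(x,y)=\sum_{S\subseteq E(T),\,|S|=1}\prod_{v\in\overline{S}}\frac{xy^{\deg(v)}}{1+xy^{\deg(v)}}=\sum_{\{v,w\}\in E(T)}\frac{xy^{\deg v}}{1+xy^{\deg v}}\cdot\frac{xy^{\deg w}}{1+xy^{\deg w}}$. The double-degree number $N_{a,b}(T)$ is the number of edges of $T$ whose endpoints have degrees $a$ and $b$ (in $T$). *)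

(* Defs.v *)
From HB Require Import structures.
From mathcomp Require Import all_boot all_order all_algebra.
From mathcomp Require Import fraction mpoly.

Set Implicit Arguments.
Unset Strict Implicit.
Unset Printing Implicit Defensive.

Import GRing.Theory.
Local Open Scope ring_scope.

Record sgraph := SGraph {
  vertex :> finType;
  adj : rel vertex;
  adj_sym : ssrbool.symmetric adj;
  adj_irr : irreflexive adj
}.

Section Graphs.
Variable G : sgraph.

Definition edges : {set {set G}} :=
  [set f : {set G} |
    [exists v : G, exists w : G, adj v w && (f == [set v; w])]].

Definition deg (v : G) : nat := #|[set w : G | adj v w]|.

Definition is_connected : Prop :=
  (0 < #|G|)%N /\ forall v w : G, connect (@adj G) v w.

(* [ucycle] also accepts the sequences [::] and [:: v; w] with v, w adjacent,
   which are not cycles of a simple graph; hence the bound on the size. *)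
Definition is_acyclic : Prop :=
  forall c : seq G, ucycle (@adj G) c -> (size c < 3)%N.

Definition is_tree : Prop := is_connected /\ is_acyclic.

Definition double_degree_number (a b : nat) : nat :=
  #|[set f in edges | [exists v : G, exists w : G,
      [&& f == [set v; w], deg v == a & deg w == b]]]|.

End Graphs.

(* The field Q(x, y). *)
Definition ratfun2 := {fraction {mpoly rat[2]}}.

Definition varx : ratfun2 := tofrac ('X_ord0 : {mpoly rat[2]}).
Definition vary : ratfun2 := tofrac ('X_ord_max : {mpoly rat[2]}).

(* [cover S] is the union of the edges in S, i.e. the set of vertices incident
   to some edge of S. *)
Definition Gamma1 (G : sgraph) : ratfun2 :=
  \sum_(S : {set {set G}} | (S \subset edges G) && (#|S| == 1%N))
    \prod_(v in cover S)
      (varx * vary ^+ deg v / (1 + varx * vary ^+ deg v)).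

Lemma Gamma1_edges (G : sgraph) :
  Gamma1 G = \sum_(f in edges G) \prod_(v in f)
    (varx * vary ^+ deg v / (1 + varx * vary ^+ deg v)).
Proof.
pose F (f : {set G}) := \prod_(v in f)
  (varx * vary ^+ deg v / (1 + varx * vary ^+ deg v)).
have inj1 : {in edges G &, injective (@set1 {set G})}.
  by move=> f g _ _ /set1_inj.
transitivity (\sum_(S in (@set1 {set G}) @: edges G) F (cover S)).
  apply: eq_bigl => S; apply/andP/imsetP => [[sSE /cards1P[f defS]]|[f Ef ->]].
    by exists f => //; move: sSE; rewrite defS sub1set.
  by rewrite sub1set cards1.
by rewrite big_imset //=; apply: eq_bigr => f _; rewrite /cover big_set1.
Qed.

(* Main.v *)
Require Import Defs.
From mathcomp Require Import all_boot.
From mathcomp Require Import all_algebra fraction mpoly zify ring.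

Set Implicit Arguments.
Unset Strict Implicit.
Unset Printing Implicit Defensive.

Import GRing.Theory.

(** Expand [Gamma1] as a power series in [x].  An edge with endpoint degrees
    [p <= q] contributes [\sum_(i, j >= 1) (-1)^(i+j) x^(i+j) y^(p i + q j)],
    so the coefficient of [x^n y^m] counts, up to sign and with multiplicity,
    the edges for which [p i + q (n - i) = m] for some [0 < i < n].  For
    [n = d + 2] and [m = a n + d] the pair [(a, a + d)] contributes, while a
    contributing pair [(p, q)] with [p <= q] has [p < a], or [p = a] and
    [q <= a + d].  The coefficients are thus triangular in the numbers
    [N_(p,q)], which are recovered by lexicographic induction on [(a, d)]. *)

(** * Power series expansions in a fraction field *)

Section Expansion.
Local Open Scope ring_scope.
Variables (A : idomainType) (x : A) (K : nat).

(* [f] lies in the localization of [A] at [1 + x A] and is congruent to [p]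
   modulo [x ^+ K] there. *)
Definition expansion (f : {fraction A}) (p : A) :=
  exists s r : A,
    f * tofrac (1 + x * s) = tofrac (p * (1 + x * s) + x ^+ K * r).

Lemma expansion0 : expansion 0 0.
Proof. by exists 0, 0; rewrite mul0r mul0r mulr0 addr0 tofrac0. Qed.

Lemma expansion1 : expansion 1 1.
Proof. by exists 0, 0; rewrite !mulr0 !addr0 !mul1r. Qed.

Lemma expansionD f g p q :
  expansion f p -> expansion g q -> expansion (f + g) (p + q).
Proof.
(* This witness makes the new denominator the product [(1 + x * s) * (1 + x * t)]. *)
move=> [s [r Ef]] [t [u Eg]]; exists (s + t + x * (s * t)).
exists (r * (1 + x * t) + u * (1 + x * s)).
have -> : 1 + x * (s + t + x * (s * t)) = (1 + x * s) * (1 + x * t) by ring.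
rewrite tofracM mulrDl mulrA Ef mulrCA Eg -!tofracM -tofracD.
by congr (tofrac _); ring.
Qed.

Lemma expansionM f g p q :
  expansion f p -> expansion g q -> expansion (f * g) (p * q).
Proof.
move=> [s [r Ef]] [t [u Eg]]; exists (s + t + x * (s * t)).
exists (p * (1 + x * s) * u + q * (1 + x * t) * r + x ^+ K * r * u).
have -> : 1 + x * (s + t + x * (s * t)) = (1 + x * s) * (1 + x * t) by ring.
rewrite tofracM mulrACA Ef Eg -tofracM.
by congr (tofrac _); ring.
Qed.

Lemma expansion_sum (I : finType) (P : pred I) (f : I -> {fraction A}) p :
  (forall i, P i -> expansion (f i) (p i)) ->
  expansion (\sum_(i | P i) f i) (\sum_(i | P i) p i).
Proof.
move=> fp; apply: (big_ind2 expansion) => //; first exact: expansion0.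
by move=> *; apply: expansionD.
Qed.

Lemma expansion_prod (I : finType) (P : pred I) (f : I -> {fraction A}) p :
  (forall i, P i -> expansion (f i) (p i)) ->
  expansion (\prod_(i | P i) f i) (\prod_(i | P i) p i).
Proof.
move=> fp; apply: (big_ind2 expansion) => //; first exact: expansion1.
by move=> *; apply: expansionM.
Qed.

(** The geometric sum telescopes against [1 + x * c], leaving the error
    [x ^+ K * (x * c * (- c) ^+ K)]. *)
Lemma expansion_geometric (c : A) : 1 + x * c != 0 ->
  expansion (tofrac (x * c) / (1 + tofrac (x * c)))
            (x * c * \sum_(k < K) (- (x * c)) ^+ k).
Proof.
move=> nz; exists c, (x * c * (- c) ^+ K).
have nzF : 1 + tofrac (x * c) != 0 by rewrite -tofrac1 -tofracD tofrac_eq0.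
rewrite tofracD tofrac1 divfK //; congr (tofrac _).
have := subrX1 (- (x * c)) K; rewrite -mulrN exprMn.
set S := \sum_(k < K) _ => /(congr1 ( *%R (- (x * c)))) E.
have -> : x * c * S * (1 + x * c) = - (x * c) * ((x * - c - 1) * S) by ring.
by rewrite -E; ring.
Qed.

(** Clearing both denominators makes [(p - q) * (1 + x * w)] a multiple of [x ^+ K], and [1 + x * w]
    is a unit modulo [x ^+ K]. *)
Lemma expansion_unique f p q :
  expansion f p -> expansion f q -> exists r, p - q = x ^+ K * r.
Proof.
move=> [s [r Ep]] [t [u Eq]].
pose w := s + t + x * (s * t).
have Dw : 1 + x * w = (1 + x * s) * (1 + x * t) by rewrite /w; ring.
have E : (p - q) * (1 + x * w) = x ^+ K * (u * (1 + x * s) - r * (1 + x * t)).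
  have /eqP : tofrac ((p * (1 + x * s) + x ^+ K * r) * (1 + x * t))
      = tofrac ((q * (1 + x * t) + x ^+ K * u) * (1 + x * s)).
    by rewrite !tofracM -Ep -Eq mulrAC.
  rewrite tofrac_eq Dw -subr_eq0 => /eqP E.
  by apply/eqP; rewrite -subr_eq0 -E; apply/eqP; ring.
(* [1 + x w] is invertible modulo [x ^+ K], by the geometric series. *)
have := subrX1 (- (x * w)) K; rewrite -mulrN exprMn.
set S := \sum_(k < K) _ => G.
exists ((u * (1 + x * s) - r * (1 + x * t)) * S + (- w) ^+ K * (p - q)).
rewrite mulrDr mulrA -E mulrA.
have -> : x ^+ K * (- w) ^+ K = 1 + (x * - w - 1) * S by rewrite -G; ring.
by ring.
Qed.

End Expansion.

(** The outer variable is x and the inner one y, so that iterated [coef] reads off the coefficient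
    of x^n y^m. *)
Local Notation bivariate :=
  (mmap (polyC \o polyC) (fun i => if i == ord0 then 'X else 'X%:P)
    : {mpoly rat[2]} -> {poly {poly rat}})%R.

(** * Coefficients of the truncated series *)

Section Coefficients.
Local Open Scope ring_scope.
Variable K : nat.

(** Truncation of u / (1 + u) at u = x y^p, exact up to degree [K] in x. *)
Definition vertex_series (p : nat) : {poly {poly rat}} :=
  'X * 'X%:P ^+ p * \sum_(k < K) (- ('X * 'X%:P ^+ p)) ^+ k.

Lemma coef_vertex_series p k : (k < K)%N ->
  (vertex_series p)`_k.+1 = (-1) ^+ k *: 'X^(p * k.+1).
Proof.
move=> kK; rewrite /vertex_series big_distrr /= coef_sum (bigD1 (Ordinal kK)) //=.
have E (i : nat) : 'X * 'X%:P ^+ p * (- ('X * 'X%:P ^+ p)) ^+ i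
    = ((-1) ^+ i *: 'X^(p * i.+1))%:P * 'X^(i.+1) :> {poly {poly rat}}.
  rewrite [in LHS]exprNn mulrCA -exprS exprMn -exprM -!rmorphXn /= -mul_polyC.
  by rewrite polyCM !(polyC_exp, polyCN) -[RHS]mulrA (mulrC 'X^(i.+1)).
rewrite E coefCM coefXn eqxx mulr1 big1 ?addr0 // => i ni.
rewrite E coefCM coefXn eqSS; case: eqP => [e|_]; last by rewrite mulr0.
by case/eqP: ni; apply: val_inj.
Qed.

Lemma coef0_vertex_series p : (vertex_series p)`_0 = 0.
Proof. by rewrite /vertex_series -!mulrA coefXM. Qed.

(** The two factors supply x-exponents [i.+1] and [n - i]. The sign depends only on [n], so
    contributions never cancel. *)
Lemma coef_edge_series p q n m : (n <= K)%N ->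
  (vertex_series p * vertex_series q)`_n.+1`_m
  = - (-1) ^+ n * (\sum_(i < n) (m == p * i.+1 + q * (n - i)))%:R.
Proof.
move=> nK; rewrite coefM big_ord_recl coef0_vertex_series mul0r add0r.
rewrite coef_sum big_ord_recr /= subSS subnn coef0_vertex_series mulr0 coef0.
rewrite addr0 natr_sum big_distrr /=; apply: eq_bigr => -[i ltin] _ /=.
have e : (n.+1 - bump 0 i = (n - i.+1).+1)%N by rewrite /bump; lia.
rewrite /bump add1n in e *; rewrite e !coef_vertex_series; try lia.
rewrite -scalerAl -scalerAr scalerA -!exprD coefZ coefXn.
have -> : (i + (n - i.+1) = n.-1)%N by lia.
have -> : ((n - i.+1).+1 = n - i)%N by lia.
by case: n ltin {nK e} => // n _; rewrite exprS mulN1r opprK.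
Qed.

End Coefficients.

(** * From [Gamma1] to polynomial coefficients *)

Section Gamma.
Local Open Scope ring_scope.
Variable K : nat.

Lemma bivariateX : bivariate 'X_ord0 = 'X.
Proof. by rewrite mmapX mmap1U. Qed.

Lemma bivariateY : bivariate 'X_ord_max = 'X%:P.
Proof. by rewrite mmapX mmap1U. Qed.

Lemma one_addXM_neq0 (c : {mpoly rat[2]}) : 1 + 'X_ord0 * c != 0.
Proof.
have E : bivariate (1 + 'X_ord0 * c) = 1 + 'X * bivariate c.
  by rewrite rmorphD rmorph1 rmorphM /= bivariateX.
apply/eqP => /(congr1 bivariate); rewrite E rmorph0; move: (bivariate c) => q.
move=> /(congr1 (coefp 0)) /eqP.
by rewrite /= coefD coefXM coef0 coef1 addr0 oner_eq0.
Qed.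

(** Counterpart of [vertex_series] in the ring whose fractions contain [Gamma1]. *)
Definition vertex_approx (p : nat) : {mpoly rat[2]} :=
  'X_ord0 * 'X_ord_max ^+ p * \sum_(k < K) (- ('X_ord0 * 'X_ord_max ^+ p)) ^+ k.

Lemma bivariate_vertex_approx p :
  bivariate (vertex_approx p) = vertex_series K p.
Proof.
rewrite /vertex_approx /vertex_series !rmorphM rmorphXn rmorph_sum /=.
rewrite bivariateX bivariateY; congr (_ * _); apply: eq_bigr => k _.
by rewrite rmorphXn rmorphN rmorphM rmorphXn /= bivariateX bivariateY.
Qed.

Lemma expansion_Gamma1 (G : sgraph) :
  expansion 'X_ord0 K (Gamma1 G)
    (\sum_(f in edges G) \prod_(v in f) vertex_approx (deg v)).
Proof.
rewrite Gamma1_edges; apply: expansion_sum => f _; apply: expansion_prod => v _.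
rewrite /varx /vary -tofracXn -tofracM.
exact: expansion_geometric (one_addXM_neq0 _).
Qed.

(** Both edge sums expand the same fraction, hence agree modulo x^K. *)
Lemma Gamma1_coef (G G' : sgraph) n : Gamma1 G = Gamma1 G' -> (n < K)%N ->
  (\sum_(f in edges G) \prod_(v in f) vertex_series K (deg v))`_n =
  (\sum_(f in edges G') \prod_(v in f) vertex_series K (deg v))`_n.
Proof.
have E (H : sgraph) : \sum_(f in edges H) \prod_(v in f) vertex_series K (deg v)
    = bivariate (\sum_(f in edges H) \prod_(v in f) vertex_approx (deg v)).
  rewrite rmorph_sum; apply: eq_bigr => f _; rewrite rmorph_prod.
  by apply: eq_bigr => v _; rewrite -bivariate_vertex_approx.
move=> eqG ltnK; have := expansion_Gamma1 G'; rewrite -eqG.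
move=> /(expansion_unique (expansion_Gamma1 G)) [r Er].
apply/eqP; rewrite -subr_eq0 -coefB !E.
move/(congr1 bivariate): Er; rewrite rmorphB rmorphM rmorphXn /=.
by rewrite bivariateX => ->; rewrite coefXnM ltnK.
Qed.

End Gamma.

(** * Edges classified by their ordered endpoint degrees *)

Section EdgeDegrees.
Variable G : sgraph.

Definition max_deg (f : {set G}) := \max_(v in f) deg v.
(* On an edge this truncated difference is the smaller endpoint degree. *)
Definition min_deg (f : {set G}) := (\sum_(v in f) deg v) - max_deg f.

Lemma edgesP f : reflect (exists v w : G, adj v w /\ f = [set v; w]) (f \in edges G).
Proof.
rewrite inE; apply: (iffP existsP) => -[v].
  by move=> /existsP[w /andP[avw /eqP->]]; exists v, w.
by move=> [w [avw ->]]; exists v; apply/existsP; exists w; rewrite avw eqxx.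
Qed.

Lemma adj_neq (v w : G) : adj v w -> v != w.
Proof. by apply: contraTneq => ->; rewrite adj_irr. Qed.

Lemma big_edge (R : Type) (idx : R) (op : Monoid.com_law idx) (F : G -> R) v w :
  adj v w -> \big[op/idx]_(u in [set v; w]) F u = op (F v) (F w).
Proof. by move/adj_neq=> nvw; rewrite big_setU1 ?inE //= big_set1. Qed.

Lemma max_deg_edge (v w : G) :
  adj v w -> max_deg [set v; w] = maxn (deg v) (deg w).
Proof. exact: big_edge. Qed.

Lemma min_deg_edge (v w : G) :
  adj v w -> min_deg [set v; w] = minn (deg v) (deg w).
Proof. by move=> avw; rewrite /min_deg max_deg_edge // big_edge //=; lia. Qed.

Lemma min_le_max_deg f : f \in edges G -> min_deg f <= max_deg f.
Proof.
by move=> /edgesP[v [w [avw ->]]]; rewrite min_deg_edge // max_deg_edge //; lia.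
Qed.

Lemma max_deg_le f : max_deg f <= #|G|.
Proof. by apply/bigmax_leqP => v _; apply: max_card. Qed.

Lemma double_degree_numberC a b :
  double_degree_number G a b = double_degree_number G b a.
Proof.
apply: eq_card => f; rewrite !inE; congr (_ && _).
by apply/existsP/existsP => -[v /existsP[w /and3P[f_ dv dw]]];
  exists w; apply/existsP; exists v; rewrite setUC f_ dv dw.
Qed.

Lemma double_degree_numberE a b : a <= b ->
  double_degree_number G a b
  = #|[set f in edges G | (min_deg f == a) && (max_deg f == b)]|.
Proof.
move=> leab; apply: eq_card => f; rewrite inE [RHS]inE.
case: edgesP => //= -[v [w [avw ->]]].
rewrite min_deg_edge // max_deg_edge //; apply/existsP/idP.
  move=> [v' /existsP[w' /and3P[/eqP e /eqP dv /eqP dw]]].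
  have nvw := adj_neq avw.
  have : v \in [set v'; w'] by rewrite -e !inE eqxx.
  have : w \in [set v'; w'] by rewrite -e !inE eqxx orbT.
  have : v' \in [set v; w] by rewrite e !inE eqxx.
  have : w' \in [set v; w] by rewrite e !inE eqxx orbT.
  move: nvw; rewrite !inE => nvw.
  (* The cases where [v'] and [w'] coincide contradict [v != w]. *)
  by case/orP=> /eqP ew; case/orP=> /eqP ev; subst v' w';
    rewrite !eqxx ?orbb ?(eq_sym w) ?(negPf nvw) //= => _ _; lia.
case: (leqP (deg v) (deg w)) => h /andP[/eqP e1 /eqP e2].
  by exists v; apply/existsP; exists w; rewrite eqxx e1 e2 !eqxx.
by exists w; apply/existsP; exists v; rewrite setUC eqxx e1 e2 !eqxx.
Qed.

(** Edges are grouped by degree pair. The free bound [M] lets two graphs share one index range. *)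
Lemma sum_edges (V : nmodType) (F : nat -> nat -> V) M : #|G| < M ->
  (\sum_(f in edges G) F (min_deg f) (max_deg f)
  = \sum_(p < M) \sum_(q < M | (p <= q)%N) F p q *+ double_degree_number G p q)%R.
Proof.
move=> ltGM; rewrite pair_big_dep /=.
have ltM f : max_deg f < M := leq_ltn_trans (max_deg_le f) ltGM.
have ltm f : f \in edges G -> min_deg f < M.
  by move=> /min_le_max_deg /leq_ltn_trans; apply.
case: M ltGM ltM ltm => // M _ ltM ltm.
pose h f : 'I_M.+1 * 'I_M.+1 := (inord (min_deg f), inord (max_deg f)).
rewrite (partition_big h (fun pq => pq.1 <= pq.2)) /=; last first.
  by move=> f Ef; rewrite !inordK ?min_le_max_deg // ltm.
apply: eq_bigr => -[p q] /= lepq; rewrite double_degree_numberE //.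
have E f : f \in edges G ->
    (h f == (p, q)) = (min_deg f == p) && (max_deg f == q).
  by move=> Ef; rewrite xpair_eqE -!val_eqE /= !inordK // ltm.
rewrite (eq_bigr (fun=> F p q)) => [|f /andP[Ef]]; last first.
  by rewrite E // => /andP[/eqP-> /eqP->].
rewrite sumr_const; congr (_ *+ _)%R; apply: eq_card => f.
by rewrite unfold_in [RHS]inE; apply: andb_id2l => /E.
Qed.

End EdgeDegrees.

(** * Triangularity of the coefficient system *)

Section Triangularity.
Variables a d : nat.

(** Up to sign, the coefficient of x^(d+2) y^(a(d+2)+d) contributed by one edge of degrees [p],
    [q]. *)
Definition pair_count p q :=
  \sum_(i < d.+1) (a * d.+2 + d == p * i.+1 + q * (d.+1 - i)).

(** If p > a, the right-hand side is at least (a+1)(d+2); if p = a, it is at least a(d+2) + (q-a).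
    Both exceed a(d+2) + d. *)
Lemma pair_count_eq0 p q : p <= q ->
  (a < p) || (p == a) && (a + d < q) -> pair_count p q = 0.
Proof.
move=> lepq h; apply/eqP; rewrite sum_nat_eq0; apply/forallP => -[i lti] /=.
have [j Ej] : exists j, d.+1 = i + j.+1 by exists (d - i); lia.
have [e Ee] : exists e, q = p + e by exists (q - p); lia.
rewrite eqb0; apply/eqP; rewrite Ee.
have -> : d.+1 - i = j.+1 by lia.
have -> : a * d.+2 + d = a * (i.+1 + j.+1) + (i + j) by congr (_ * _ + _); lia.
by case/orP: h => [h|/andP[/eqP h1 h2]]; nia.
Qed.

Lemma pair_count_gt0 : 0 < pair_count a (a + d).
Proof.
(* The last index takes exponent d+1 at degree a and exponent 1 at degree a+d. *)
rewrite /pair_count (bigD1 ord_max) //= subSnn muln1.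
by have -> : (a * d.+2 + d == a * d.+1 + (a + d)) by apply/eqP; lia.
Qed.

End Triangularity.

(** * Recovery of the double-degree numbers *)

Lemma double_degree_number_lex (G G' : sgraph) : Gamma1 G = Gamma1 G' ->
  forall a d, double_degree_number G a (a + d) = double_degree_number G' a (a + d).
Proof.
move=> eqG; elim/ltn_ind=> a IHa; elim/ltn_ind=> d IHd.
(* [M] exceeds all degrees in both graphs as well as [a + d]; [K] must exceed the x-degree d+2. *)
pose M := (#|G| + #|G'| + a + d).+1; pose K := d.+3.
have prodE (H : sgraph) f : f \in edges H ->
    (\prod_(v in f) vertex_series K (deg v)
     = vertex_series K (min_deg f) * vertex_series K (max_deg f))%R.
  move=> /edgesP[v [w [avw ->]]]; rewrite big_edge //= min_deg_edge //.
  by rewrite max_deg_edge //; case: leqP => _ //; rewrite mulrC.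
have coefE (H : sgraph) : #|H| < M ->
    ((\sum_(f in edges H) \prod_(v in f) vertex_series K (deg v))
       `_d.+2`_(a * d.+2 + d)
    = - (-1) ^+ d.+1 * (\sum_(p < M) \sum_(q < M | p <= q)
        pair_count a d p q * double_degree_number H p q)%N%:R)%R.
  move=> ltHM; rewrite !coef_sum natr_sum big_distrr /=.
  pose F p q : rat := (- (-1) ^+ d.+1 * (pair_count a d p q)%:R)%R.
  rewrite (eq_bigr (fun f => F (min_deg f) (max_deg f))); last first.
    by move=> f Ef; rewrite prodE // coef_edge_series // /K; lia.
  rewrite (sum_edges F ltHM).
  apply: eq_bigr => p _; rewrite natr_sum big_distrr /=.
  by apply: eq_bigr => q _; rewrite natrM mulrA mulr_natr.
have := congr1 (fun c : {poly rat} => c`_(a * d.+2 + d))%R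
  (Gamma1_coef eqG (ltnSn d.+2)).
rewrite !coefE ?/M; try lia.
move=> /mulfI; rewrite oppr_eq0 signr_eq0 => /(_ isT) /eqP.
rewrite Num.Theory.eqr_nat => /eqP.
have lta : a < M by rewrite /M; lia.
have ltad : a + d < M by rewrite /M; lia.
(* Isolate the pair (a, a+d): [X] gathers the rest of row [a], [Y] the other rows. *)
rewrite !(bigD1 (P := xpredT) (Ordinal lta)) //=.
rewrite !(bigD1 (P := fun q : 'I_M => a <= q) (Ordinal ltad)) ?leq_addr //=.
set X := \sum_(i < M | _ && _) _; set Y := \sum_(i < M | _) _.
set X' := \sum_(i < M | _ && _) _; set Y' := \sum_(i < M | _) _.
have -> : X = X'.
  apply: eq_bigr => q /andP[leaq nq].
  (* Smaller [q] fall under [IHd]; larger ones have zero [pair_count]. *)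
  have [ltq|geq] := ltnP (q : nat) (a + d).
    by have := IHd (q - a); rewrite subnKC // => -> //; lia.
  by rewrite pair_count_eq0 //; rewrite ltnn eqxx ltn_neqAle eq_sym geq andbT.
have -> : Y = Y'.
  apply: eq_bigr => p np; apply: eq_bigr => q lepq.
  have [ltp|gep] := ltnP (p : nat) a.
    by have := IHa p ltp (q - p); rewrite subnKC // => ->.
  by rewrite pair_count_eq0 //; rewrite ltn_neqAle (eq_sym a) gep andbT np.
move=> /addIn /addIn /eqP; rewrite eqn_pmul2l ?pair_count_gt0 //.
by move/eqP.
Qed.

Theorem theorem4p4 (T T' : sgraph) (hT : is_tree T) (hT' : is_tree T')
    (hG : Gamma1 T = Gamma1 T') (a b : nat) (ha : 0 < a) (hb : 0 < b) :
  double_degree_number T a b = double_degree_number T' a b.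
Proof.
(* By symmetry the pair can be put in the form (a, a+d). *)
wlog leab : a b {ha hb} / a <= b => [H|].
  have [/H//|/ltnW/H E] := leqP a b.
  by rewrite double_degree_numberC E double_degree_numberC.
by rewrite -(subnKC leab); apply: double_degree_number_lex.
Qed.
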